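(* Let $a$ be a finitely supported sequence on $\mathbb{Z}$, and consider the convolution operator $Af=a*f$ on $\ell^2(\mathbb{Z})$. Let $N\ge 0$ and $L\ge 0$ be integers, let $I=\{-N,\dots,N\}\subset\mathbb{Z}$ and $\Omega\subset I$. Let $J\subset\mathbb{Z}$ be an index set, let $N_j\in\mathbb{Z}$ for $j\in J$, and put $I_j=I+N_j\subset\mathbb{Z}$. Assume that $\bigcup_{j\in J}I_j=\mathbb{Z}$ and that there is a positive integer $M$ with $I_j\cap I_k=\emptyset$ whenever $|j-k|>M$. Assume that $G_0=\{\chi_I\,a^n(\cdot-l): l\in\Omega,\ 0\le n\le L\}$ is a frame for $\ell^2(I)$. Then $\bigcup_{j\in J}S_{N_j}G_0$ is a frame for $\ell^2(\mathbb{Z})$.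
   Context: $a^n$ denotes the $n$-fold convolution of $a$ with itself, with $a^0=\delta_0$; thus $a^n(\cdot-l)=A^n\delta_l$, where $\delta_l$ is the sequence equal to $1$ at $l$ and $0$ elsewhere. $\chi_I$ is the characteristic function of $I$. $S_k$ is the shift operator $(S_kf)(i)=f(i-k)$ on $\ell^2(\mathbb{Z})$. The space $\ell^2(I)$ is identified with the sequences in $\ell^2(\mathbb{Z})$ supported in $I$. The union $\bigcup_j S_{N_j}G_0$ is understood as the family $\{S_{N_j}g\}$ indexed by $j\in J$ and the elements $g$ of $G_0$. A countable family $\{f_i\}$ in a Hilbert space $\mathcal{H}$ is a frame for $\mathcal{H}$ if there exist $\alpha,\beta>0$ with $\alpha\|f\|^2\le\sum_i|\langle f,f_i\rangle|^2\le\beta\|f\|^2$ for all $f\in\mathcal{H}$. *)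

(* Defs.v *)
From HB Require Import structures.
From mathcomp Require Export all_boot all_order all_algebra.
From mathcomp Require Export complex.
From mathcomp Require Export all_classical all_reals all_analysis.
From mathcomp.analysis.showcase Require summability.
Export Order.TTheory GRing.Theory Num.Theory.
Export numFieldNormedType.Exports.

Set Implicit Arguments.
Unset Strict Implicit.
Unset Printing Implicit Defensive.

Local Open Scope classical_set_scope.
Local Open Scope ring_scope.
Local Open Scope complex_scope.

Section Sequences.
Context {R : realType}.
Implicit Types (f g a : int -> R[i]) (X : set int).

(* [normc z : R] is the real modulus; the generic norm of [R[i]] takes values
   in [R[i]] and could not be compared in [\bar R]. *)
Definition sqmod (z : R[i]) : R := ComplexField.Normc.normc z ^+ 2.

Definition l2normsq f : \bar R := \esum_(k in [set: int]) (sqmod (f k))%:E.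

(* The space l^2(X), as the sequences of l^2(Z) supported in X. *)
Definition l2 X : set (int -> R[i]) :=
  [set f | (l2normsq f < +oo)%E /\ forall k, ~ X k -> f k = 0].

(* [summability.sum] is the limit of the finite partial sums, which exists
   whenever [f] and [g] are square summable. *)
Definition inner f g : R[i] :=
  summability.sum (fun k : int => f k * (g k)^* : (R[i])^o).

(* A countable family [(F i)_(i in D)] of vectors of the closed subspace [H] of
   l^2(Z) is a frame for [H]. The sum is the unconditional sum of nonnegative
   terms, in the extended reals. *)
Definition is_frame (H : set (int -> R[i])) (T : choiceType) (D : set T)
    (F : T -> int -> R[i]) : Prop :=
  [/\ countable D,
      forall i, D i -> H (F i) &
      exists alpha beta : R,
        [/\ 0 < alpha, 0 < beta &
            forall f, H f ->
              (alpha%:E * l2normsq f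
                 <= \esum_(i in D) (sqmod (inner f (F i)))%:E)%E /\
              (\esum_(i in D) (sqmod (inner f (F i)))%:E
                 <= beta%:E * l2normsq f)%E]].

Definition finitely_supported a : Prop := finite_set [set k | a k != 0].

(* The sum ranges over the finite support of the summand; it is the convolution
   for finitely supported [a]. *)
Definition conv a f : int -> R[i] :=
  fun i => \sum_(m \in [set: int]) a m * f (i - m).

Definition delta (l : int) : int -> R[i] := \1_[set l].

Definition conv_pow a (n : nat) : int -> R[i] := iter n (conv a) (delta 0).

Definition shift (k : int) f : int -> R[i] := fun i => f (i - k).

End Sequences.

Definition window (N : nat) : set int := [set k | - N%:Z <= k <= N%:Z].

Definition translate (X : set int) (t : int) : set int := [set k + t | k in X].

Definition G0 {R : realType} (a : int -> R[i]) (N L : nat) (Omega : set int) :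
    set (int -> R[i]) :=
  [set g | exists l n, [/\ Omega l, (n <= L)%N &
     g = fun k => \1_(window N) k * shift l (conv_pow a n) k]].

(* Main.v *)
(* Pairing f with a translate S_{N_j} g of an element g of G_0 is pairing with g
   the block of f over I_j, moved back to I.  The frame bounds of G_0 thus hold
   on every block, and summing them over j compares the frame sum with the sum
   over j of ||f chi_{I_j}||^2.  Counting how often each integer is covered,
   the latter lies between ||f||^2 (the I_j cover Z) and (2M+1) ||f||^2 (the
   indices of the I_j containing a given integer differ by at most M). *)
Require Import Defs.
From mathcomp Require Import finmap zify.

Local Open Scope classical_set_scope.
Local Open Scope ring_scope.
Local Open Scope complex_scope.

(** Taking images under a bijection permutes the finite sets and preserves inclusion, so the finite
    sets containing a given one correspond to those containing its image or preimage. *)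
Lemma totally_imfset (I : choiceType) (e e' : I -> I) :
  cancel e e' -> cancel e' e ->
  (fun A : {fset I} => [fset e i | i in A]%fset) @ summability.totally
    = summability.totally.
Proof.
move=> eK e'K; apply/seteqP; split => P [A _ AP].
- exists [fset e i | i in A]%fset => // B /= AB.
  have -> : B = [fset e i | i in [fset e' i | i in B]]%fset.
    rewrite -[LHS]imfset_id -imfset_comp; apply: eq_imfset => // i /=.
    by rewrite e'K.
  apply: AP => /=; apply/fsubsetP => i iA; apply/imfsetP; exists (e i) => //.
  by apply: (fsubsetP AB); rewrite in_imfset.
- exists [fset e' i | i in A]%fset => // B /= AB; apply: AP => /=.
  apply/fsubsetP => i iA; apply/imfsetP; exists (e' i) => //.
  by apply: (fsubsetP AB); rewrite in_imfset.
Qed.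

(** The partial sum of [x \o e] over [A] is that of [x] over the image of [A], so both sums are
    limits along the same filter. *)
Lemma sum_reindex (I : choiceType) (K : numDomainType) (V : normedModType K)
    (e e' : I -> I) (x : I -> V) :
  cancel e e' -> cancel e' e ->
  summability.sum (x \o e) = summability.sum x.
Proof.
move=> eK e'K; rewrite /summability.sum -[in RHS](totally_imfset _ _ _ eK e'K).
congr (lim _); rewrite -[RHS]/((_ \o _) @ summability.totally).
congr (_ @ summability.totally); apply/funext => A /=.
rewrite /summability.partial_sum -(big_seq_fsetE _ _ xpredT) /=.
rewrite -(big_seq_fsetE _ _ xpredT) /= big_imfset //=.
by move=> i j _ _; exact: can_inj eK i j.
Qed.

Lemma esumZl (R : realType) (T : choiceType) (D : set T) (c : R)
    (a : T -> \bar R) : 0 < c -> (forall i, (0 <= a i)%E) ->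
  (\esum_(i in D) (c%:E * a i) = c%:E * \esum_(i in D) a i)%E.
Proof.
have le (k : R) (b : T -> \bar R) : 0 < k -> (forall i, (0 <= b i)%E) ->
    (\esum_(i in D) (k%:E * b i) <= k%:E * \esum_(i in D) b i)%E.
  move=> k0 b0; apply: ge_ereal_sup => _ [X [finX XD] <-].
  rewrite -ge0_mule_fsumr//; apply: lee_wpmul2l; first by rewrite lee_fin ltW.
  by apply: ereal_sup_ubound; exists X.
move=> c0 a0; apply/eqP; rewrite eq_le le//=.
(* The reverse inequality is [le] itself, applied to the factor [c^-1] and the terms [c * a i]. *)
have : (\esum_(i in D) a i <= c^-1%:E * \esum_(i in D) (c%:E * a i))%E.
  rewrite [leLHS](@eq_esum _ _ _ _ (fun i => c^-1%:E * (c%:E * a i))%E).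
    by apply: le => [|i]; rewrite ?invr_gt0// mule_ge0// lee_fin ltW.
  by move=> i _; rewrite muleA -EFinM mulVf ?gt_eqF// mul1e.
move=> /(lee_wpmul2l (_ : 0 <= c%:E)%E); rewrite lee_fin => /(_ (ltW c0)).
by rewrite muleA -EFinM mulfV ?gt_eqF// mul1e.
Qed.

Lemma esum_cst_le (R : realType) (T : choiceType) (D : set T) (n : nat)
    (c : \bar R) :
  (D #<= `I_n)%card -> (0 <= c)%E -> (\esum_(i in D) c <= n%:R%:E * c)%E.
Proof.
move=> Dn c0.
have finD : finite_set D by apply: card_le_finite Dn _; exact: finite_II.
rewrite esum_fset// fsbig_finite//= big_const_seq count_predT.
have -> m : iter m (+%E c) 0%E = (m%:R%:E * c)%E.
  elim: m => [|m /= ->]; first by rewrite mul0e.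
  by rewrite -{1}[c]mul1e -ge0_muleDl ?lee_fin// -EFinD nat1r.
apply: lee_wpmul2r => //; rewrite lee_fin ler_nat.
exact: geq_card_fset_set.
Qed.

(** Both sides sum nonnegative terms over the pairs of [j] in [J] and [k] in [U j]. On the right,
    [a k] is repeated once for each index whose set contains [k]. *)
Lemma esum_family (R : realType) (T I : choiceType) (J : set I)
    (U : I -> set T) (a : T -> \bar R) : (forall k, (0 <= a k)%E) ->
  (\esum_(j in J) \esum_(k in U j) a k =
   \esum_(k in [set: T]) \esum_(j in J `&` [set j | U j k]) a k)%E.
Proof.
move=> a0; rewrite !esum_esum//.
rewrite (@reindex_esum _ _ _ ([set: T] `*`` (fun k => J `&` [set j | U j k])) _
  (fun p => (p.2, p.1)))//; split.
- by move=> [k j] /= [_ []].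
- by move=> [k j] [k' j'] _ _ /= [-> ->].
- by move=> [j k] /= [Jj Ujk]; exists (k, j).
Qed.

Lemma esum_cover_ge (R : realType) (T I : choiceType) (J : set I)
    (U : I -> set T) (a : T -> \bar R) : (forall k, (0 <= a k)%E) ->
  \bigcup_(j in J) U j = [set: T] ->
  (\esum_(k in [set: T]) a k <= \esum_(j in J) \esum_(k in U j) a k)%E.
Proof.
move=> a0 JU; rewrite esum_family//; apply: le_esum => k _.
have [j Jj Ujk] : (\bigcup_(j in J) U j) k by rewrite JU.
(* A single index covering [k] already contributes [a k] to the inner sum. *)
apply: esum_ge; exists [set j]; last by rewrite fsbig_set1.
by split; [exact: finite_set1|move=> _ ->].
Qed.

Lemma esum_overlap_le (R : realType) (T I : choiceType) (J : set I)
    (U : I -> set T) (n : nat) (a : T -> \bar R) : (0 < n)%N ->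
  (forall k, (0 <= a k)%E) -> (forall k, J `&` [set j | U j k] #<= `I_n)%card ->
  (\esum_(j in J) \esum_(k in U j) a k
     <= n%:R%:E * \esum_(k in [set: T]) a k)%E.
Proof.
move=> n0 a0 Un; rewrite esum_family// -esumZl ?ltr0n//.
by apply: le_esum => k _; exact: esum_cst_le.
Qed.

Section Shift.
Context {R : realType}.
Implicit Types (f g : int -> R[i]) (X : set int) (t : int).

Lemma sqmod_ge0 (z : R[i]) : 0 <= sqmod z.
Proof. exact: sqr_ge0. Qed.

Lemma sqmod0 : sqmod (0 : R[i]) = 0.
Proof. by rewrite /sqmod ComplexField.Normc.normc0 expr0n. Qed.

Lemma l2normsq_ge0 f : (0 <= l2normsq f)%E.
Proof. by apply: esum_ge0 => k _; rewrite lee_fin sqmod_ge0. Qed.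

Lemma l2normsq_shift t f : l2normsq (shift t f) = l2normsq f.
Proof.
rewrite /l2normsq.
rewrite [RHS](@reindex_esum _ _ _ [set: int] _ (fun k => k - t))//; split => //.
- by move=> i j _ _ /= /addIr.
- by move=> j _; exists (j + t); rewrite ?addrK.
Qed.

Lemma inner_shiftr t f g : inner f (shift t g) = inner (shift (- t) f) g.
Proof.
have eK : cancel (fun k : int => k + t) (fun k => k - t).
  by move=> k; rewrite addrK.
have e'K : cancel (fun k : int => k - t) (fun k => k + t).
  by move=> k; rewrite subrK.
rewrite /inner -[LHS](sum_reindex int _ _ _ _ _ eK e'K).
apply f_equal; apply/funext => k.
by rewrite /shift /= opprK addrK.
Qed.

(** Extension by zero keeps the restriction a sequence on all of Z, as membership in [l2 X]
    requires. *)
Definition restr X f : int -> R[i] := fun k => if k \in X then f k else 0.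

Lemma inner_restr X f g :
  (forall k, ~ X k -> g k = 0) -> inner (restr X f) g = inner f g.
Proof.
move=> gX; rewrite /inner; apply f_equal; apply/funext => k; rewrite /restr.
by case: ifPn => // /negP kX; rewrite gX ?conjC0 ?mulr0// => /mem_set.
Qed.

Lemma l2normsq_restr X f :
  l2normsq (restr X f) = (\esum_(k in X) (sqmod (f k))%:E)%E.
Proof.
rewrite [RHS]esum_mkcond; apply: eq_esum => k _; rewrite /restr.
by case: ifP => //; rewrite sqmod0.
Qed.

Lemma l2_restr X f : l2 [set: int] f -> l2 X (restr X f).
Proof.
move=> [foo _]; split; last first.
  by move=> k Xk; rewrite /restr memNset.
apply: le_lt_trans foo; apply: le_esum => k _; rewrite /restr.
by case: ifP => // _; rewrite sqmod0 lee_fin sqmod_ge0.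
Qed.

Lemma l2normsq_restr_shift X t f :
  l2normsq (restr X (shift (- t) f)) =
  (\esum_(k in translate X t) (sqmod (f k))%:E)%E.
Proof.
rewrite l2normsq_restr /translate esum_image; last by move=> ? ? _ _ /addIr.
by apply: eq_esum => k _; rewrite /shift opprK.
Qed.

End Shift.

Lemma card_int_ball (A : set int) (M : nat) :
  (forall j k, A j -> A k -> `|j - k| <= M%:Z) -> (A #<= `I_(M.*2.+1))%card.
Proof.
have [->|/set0P[j0 Aj0] AM] := eqVneq A set0; first by rewrite card_ge0.
(* With [j0] in [A] fixed, [A] lies in the interval from [j0 - M] to [j0 + M], an image of the first
   2M+1 naturals. *)
apply: card_le_trans
  (card_image_le (fun i : nat => j0 - M%:Z + i%:Z) `I_(M.*2.+1)).
apply: subset_card_le => j Aj; have := AM _ _ Aj Aj0.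
rewrite ler_norml => /andP[lo hi].
exists `|(j - j0 + M%:Z)%R|%N => /=; lia.
Qed.

Theorem proposition3p3 (R : realType) (a : int -> R[i])
    (ha : finitely_supported a)
    (N L : nat) (Omega : set int) (hOmega : Omega `<=` window N)
    (J : set int) (Nj : int -> int)
    (hcover : \bigcup_(j in J) translate (window N) (Nj j) = [set: int])
    (hdisj : exists M : nat, (0 < M)%N /\
       forall j k, J j -> J k -> M%:Z < `|j - k| ->
         translate (window N) (Nj j) `&` translate (window N) (Nj k) = set0)
    (hG0 : is_frame (l2 (window N)) (G0 a N L Omega) id) :
  is_frame (l2 [set: int]) (J `*` G0 a N L Omega)
    (fun p => shift (Nj p.1) p.2).
Proof.
have [cG GH [alpha [beta [alpha0 beta0 frameG]]]] := hG0.
have [M [_ disjM]] := hdisj.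
set X := window N in hcover disjM GH frameG *.
have sum_blocks f : (\esum_(p in J `*` G0 a N L Omega)
      (sqmod (inner f (shift (Nj p.1) p.2)))%:E =
    \esum_(j in J) \esum_(g in G0 a N L Omega)
      (sqmod (inner (restr X (shift (- Nj j) f)) g))%:E)%E.
  rewrite esum_esum; last by move=> *; rewrite lee_fin sqmod_ge0.
  (* Since [g] vanishes off the window, the pairing sees only the part of the shifted [f] inside
     it. *)
  apply: eq_esum => -[j g] [/= _ /GH[_ gX]].
  by rewrite inner_shiftr inner_restr.
have blockG (f : int -> R[i]) j :
    l2 [set: int] f -> l2 X (restr X (shift (- Nj j) f)).
  by move=> [foo _]; apply: l2_restr; split=> [|k []//]; rewrite l2normsq_shift.
have normX (f : int -> R[i]) :
    (\esum_(j in J) l2normsq (restr X (shift (- Nj j) f)) =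
    \esum_(j in J) \esum_(k in translate X (Nj j)) (sqmod (f k))%:E)%E.
  by apply: eq_esum => j _; exact: l2normsq_restr_shift.
have overlap k : (J `&` [set j | translate X (Nj j) k] #<= `I_(M.*2.+1))%card.
  (* If two indices covering [k] differed by more than [M], then [k] would lie in an intersection
     that [disjM] makes empty. *)
  apply: card_int_ball => i j [Ji Xi] [Jj Xj]; rewrite leNgt; apply/negP => Mij.
  suff : (@set0 int) k by [].
  by rewrite -(disjM i j Ji Jj Mij).
split.
- by apply: countableX => //; exact: countableP.
- move=> [j g] [/= _ /GH[goo _]]; split=> [|k []//].
  by rewrite l2normsq_shift.
(* Covering each integer at least once preserves [alpha]; covering it at most 2M+1 times costs that
   factor in the upper bound. *)
- exists alpha, (beta * M.*2.+1%:R); split=> //; first by rewrite mulr_gt0.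
  move=> f Hf; rewrite sum_blocks; split.
  + apply: (@le_trans _ _
      (\esum_(j in J) (alpha%:E * l2normsq (restr X (shift (- Nj j) f))))%E).
      rewrite (esumZl _ _ _ _ _ _ (fun=> l2normsq_ge0 _))// normX; apply: lee_wpmul2l; first by rewrite lee_fin ltW.
      by apply: esum_cover_ge => // k; rewrite lee_fin sqmod_ge0.
    by apply: le_esum => j _; have [] := frameG _ (blockG f j Hf).
  + apply: (@le_trans _ _
      (\esum_(j in J) (beta%:E * l2normsq (restr X (shift (- Nj j) f))))%E).
      by apply: le_esum => j _; have [] := frameG _ (blockG f j Hf).
    rewrite (esumZl _ _ _ _ _ _ (fun=> l2normsq_ge0 _))// normX EFinM -muleA.
    apply: lee_wpmul2l; first by rewrite lee_fin ltW.
    by apply: esum_overlap_le => // k; rewrite lee_fin sqmod_ge0.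
Qed.
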